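(* Let $G$ be a compact group, let $\pi : G \to GL(\mathbb{R}^N)$ be a continuous linear representation, and let $V_0 = \operatorname{range}(\langle\pi\rangle)=\{\langle \pi\rangle x : x\in\mathbb{R}^N\}$, where $\langle \pi\rangle$ is the Haar average of $\pi$ over $G$. Let $N_{VC}^{\pi}$ (the VC dimension for $G$-invariant perceptrons with representation $\pi$) denote the maximum number $P$ such that there exist $P$ points $r^1,\dots,r^P\in\mathbb{R}^N$ for which, for every choice of labels $(y^\mu)_{\mu=1}^P\in\{-1,+1\}^P$, the dataset $\{(\pi(g) r^\mu, y^\mu)\}_{\mu\in\{1,\dots,P\},\, g\in G}$ is linearly separable. Then $N_{VC}^{\pi} = \dim(V_0)$.
   Context: $\langle\pi\rangle = \langle \pi(g)\rangle_{g\in G}$ denotes the average with respect to the normalized Haar measure on $G$ (for finite $G$, $\frac{1}{|G|}\sum_{g\in G}\pi(g)$). The labeled dataset $\{(\pi(g) r^\mu, y^\mu)\}$ is linearly separable if there exists $w\in\mathbb{R}^N$ with $y^\mu w^\top\pi(g)r^\mu>0$ for all $g\in G$ and all $\mu$ (no bias term). The value $P=0$ is allowed (vacuously separable) in the definition of the maximum. *)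

(* Defs.v *)
From HB Require Import structures.
From mathcomp Require Import all_boot all_order all_algebra.
From mathcomp Require Import all_classical all_reals all_analysis.
Set Implicit Arguments.
Unset Strict Implicit.
Unset Printing Implicit Defensive.
Import Order.TTheory GRing.Theory Num.Theory.
Import numFieldNormedType.Exports.
Local Open Scope classical_set_scope.
Local Open Scope ring_scope.

HB.mixin Record isTopologicalGroup G & Topological G & Group G := {
  mulg_continuous : continuous (fun x : G * G => (x.1 * x.2)%g) ;
  invg_continuous : continuous (fun x : G => (x^-1)%g)
}.

(* The point (any element, e.g. the identity) is required only because the
   generated sigma-algebras of the library live on pointed types. *)
#[short(type="topologicalGroupType")]
HB.structure Definition TopologicalGroup :=
  {G of Pointed G & Topological G & Group G & isTopologicalGroup G}.

Notation borel G := (g_sigma_algebraType (@open G)).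

Section Haar.
Context {R : realType} {G : topologicalGroupType}.

(* Normalization and countable additivity are part of [probability].
   Closedness of the compact sets is automatic when G is Hausdorff; it is what
   makes them Borel otherwise. *)
Record normalized_haar (mu : probability (borel G) R) : Prop := {
  haar_left_invariant : forall (g : G) (A : set (borel G)), measurable A ->
    mu [set (g * h)%g | h in A] = mu A ;
  haar_outer_regular : forall A : set (borel G), measurable A ->
    mu A = ereal_inf [set mu U | U in [set U : set G | open U /\ A `<=` U]] ;
  haar_inner_regular : forall U : set G, open U ->
    mu U = ereal_sup
      [set mu K | K in [set K : set G | [/\ compact K, closed K & K `<=` U]]]
}.

Definition haar_average (mu : probability (borel G) R) (N : nat)
    (pi : G -> 'M[R]_N) : 'M[R]_N :=
  \matrix_(i, j) \int[mu]_(g in [set: borel G]) pi g i j.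

End Haar.

Definition continuous_representation (R : realType) (G : topologicalGroupType)
    (N : nat) (pi : G -> 'M[R]_N) : Prop :=
  [/\ forall g, pi g \in unitmx,
      forall g h, pi (g * h)%g = pi g *m pi h
    & continuous pi].

Definition range_space (R : fieldType) (N : nat) (A : 'M[R]_N) :
    {vspace 'cV[R]_N} :=
  limg (linfun (fun x : 'cV[R]_N => A *m x)).

Definition linearly_separable (R : realType) (N : nat) (I : Type)
    (x : I -> 'cV[R]_N) (y : I -> R) : Prop :=
  exists w : 'cV[R]_N, forall i, 0 < y i * (w^T *m x i) 0 0.

Definition invariantly_shattered (R : realType) (G : Type) (N P : nat)
    (pi : G -> 'M[R]_N) (r : 'I_P -> 'cV[R]_N) : Prop :=
  forall y : 'I_P -> R, (forall m, y m \in [:: -1; 1]) ->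
    linearly_separable (fun mg : 'I_P * G => pi mg.2 *m r mg.1)
                       (fun mg : 'I_P * G => y mg.1).

(* [is_VC_dim pi d] says that d is the maximum of the set of admissible P. *)
Definition is_VC_dim (R : realType) (G : Type) (N : nat) (pi : G -> 'M[R]_N)
    (d : nat) : Prop :=
  let S := [set P | exists r : 'I_P -> 'cV[R]_N, invariantly_shattered pi r] in
  S d /\ ubound S d.

(* Main.v *)
Require Import Defs.
From mathcomp Require Import all_boot all_order all_algebra.
From mathcomp Require Import all_classical all_reals all_analysis.
From mathcomp Require Import measurable_realfun.
Import numFieldNormedType.Exports.
Local Open Scope classical_set_scope.
Local Open Scope ring_scope.
Import Order.TTheory GRing.Theory Num.Theory.

Set Implicit Arguments.
Unset Strict Implicit.
Unset Printing Implicit Defensive.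

(* Left invariance gives [pi g *m M = M] for the Haar average [M], so the range
   of [M] consists of fixed vectors, and a basis of it is shattered because
   linear functionals take arbitrary values on a basis.  Conversely, averaging
   [0 < y * (w^T *m (pi g *m r)) 0 0] over [g] gives the same inequality for
   [M *m r]: if the [r]'s are shattered then so are the vectors [M *m r], and
   vectors that realise every sign pattern are linearly independent. *)

(** * Integration of continuous functions on a compact space *)

Lemma borel_continuous_measurable_fun (T : ptopologicalType) (R : realType)
    (f : T -> R) :
  continuous f -> measurable_fun [set: borel T] (f : borel T -> R).
Proof.
move=> /continuousP cf.
apply: (measurability _ (RGenOpens.measurableE R)).
move=> _ [_ [a [b ->] <-]]; rewrite setTI.
by apply: sub_sigma_algebra; exact/cf/interval_open.
Qed.

Lemma borel_continuous_integrable (T : ptopologicalType) (R : realType)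
    (mu : {finite_measure set (borel T) -> \bar R}) (f : T -> R) :
  compact [set: T] -> continuous f ->
  mu.-integrable [set: borel T] (EFin \o (f : borel T -> R)).
Proof.
move=> Tcompact cf; apply: measurable_bounded_integrable => //.
- by rewrite -ge0_fin_numE// fin_num_measure.
- exact: borel_continuous_measurable_fun.
- have : bounded_set (f @` setT).
    apply/compact_bounded/continuous_compact => //.
    exact: continuous_subspaceT.
  case=> M [Mr fM]; exists M; split=> // K MK x _.
  by apply: (fM K MK); exists x.
Qed.

Lemma Rintegral_sum d (T : measurableType d) (R : realType)
    (mu : {measure set T -> \bar R}) (I : Type) (s : seq I) (P : pred I)
    (f : I -> T -> R) (D : set T) : measurable D ->
  (forall i, mu.-integrable D (EFin \o f i)) ->
  \int[mu]_(x in D) (\sum_(i <- s | P i) f i x) =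
  \sum_(i <- s | P i) \int[mu]_(x in D) f i x.
Proof.
move=> mD fint; rewrite /Rintegral.
under eq_integral do rewrite -sumEFin.
rewrite (integral_sum mD fint).
rewrite (eq_bigr (fun i => (\int[mu]_(x in D) f i x)%:E)).
  by rewrite sumEFin.
move=> i _; rewrite /Rintegral fineK//.
by apply: integrable_fin_num => //; exact: fint.
Qed.

Lemma ge_cst_Rintegral d (T : measurableType d) (R : realType)
    (mu : probability T R) (f : T -> R) (c : R) :
  mu.-integrable [set: T] (EFin \o f) -> (forall x, c <= f x) ->
  c <= \int[mu]_(x in [set: T]) f x.
Proof.
move=> intf cf.
have <- : \int[mu]_(x in [set: T]) c = c.
  by rewrite Rintegral_cst//= probability_setT mulr1.
apply: le_Rintegral => //.
exact: finite_measure_integrable_cst.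
Qed.

(** By compactness [f] attains its minimum, so it is bounded below by a positive constant, and a
    probability measure integrates that constant to itself. This keeps the inequality strict after
    averaging. *)
Lemma Rintegral_gt0 (T : ptopologicalType) (R : realType)
    (mu : probability (borel T) R) (f : T -> R) :
  compact [set: T] -> continuous f -> (forall x, 0 < f x) ->
  0 < \int[mu]_(x in [set: borel T]) f x.
Proof.
move=> Tcompact cf f_gt0.
have [|c _ fmin] :=
  @compact_EVT_min T R f setT _ Tcompact (continuous_subspaceT cf).
  by exists point.
apply: (lt_le_trans (f_gt0 c)); apply: ge_cst_Rintegral.
  exact: borel_continuous_integrable.
by move=> x; apply: fmin; rewrite inE.
Qed.

(** * Left translations and the Haar integral *)

Lemma mulg_continuousr (G : topologicalGroupType) (g : G) :
  continuous (fun h => g * h)%g.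
Proof.
move=> h.
apply: (@continuous_comp _ _ _ (fun h => (g, h)) (fun x : G * G => x.1 * x.2)%g).
  by apply: cvg_pair => /=; [exact: cvg_cst|exact: cvg_id].
exact: mulg_continuous.
Qed.

Lemma measurable_mulg (G : topologicalGroupType) (g : G) :
  measurable_fun [set: borel G] ((fun h => g * h)%g : borel G -> borel G).
Proof.
apply: (@measurability _ _ (borel G) (borel G) _ _ (@open G)) => //.
move=> _ [U oU <-]; rewrite setTI.
by apply: sub_sigma_algebra; move/continuousP: (@mulg_continuousr G g); exact.
Qed.

Lemma haar_Rintegral_mulg (R : realType) (G : topologicalGroupType)
    (mu : probability (borel G) R) (f : G -> R) (g : G) :
  compact [set: G] -> normalized_haar mu -> continuous f ->
  \int[mu]_(h in [set: borel G]) f (g * h)%g =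
  \int[mu]_(h in [set: borel G]) f h.
Proof.
move=> Gcompact haar cf; rewrite /Rintegral; congr fine.
have mg := measurable_mulg g.
(* The measure [mu] agrees with its pushforward under translation by [g], so the claim becomes the
   change of variables formula. *)
rewrite [RHS](@eq_measure_integral _ _ _ _
  (pushforward mu ((fun h => g * h)%g : borel G -> borel G))).
  rewrite integral_pushforward//.
  - by apply/measurable_EFinP; exact: borel_continuous_measurable_fun.
  - rewrite preimage_setT.
    apply: (@borel_continuous_integrable G R mu (fun h => f (g * h)%g)) => // h.
    by apply: continuous_comp; [exact: mulg_continuousr|exact: cf].
move=> A mA _; rewrite /= /pushforward.
have mA' : measurable ((fun h => g * h)%g @^-1` A : set (borel G)).
  by rewrite -[X in measurable X]setTI; exact: mg.
(* Invariance is applied to the preimage of [A], whose translate by [g] is [A] itself. *)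
rewrite -[RHS](haar_left_invariant haar g)//; congr (mu _).
rewrite eqEsubset; split=> [h Ah|_ [h Ah <-]//].
by exists (g^-1 * h)%g; rewrite /= mulVKg.
Qed.

(** * Bilinear forms of the representation and of its average *)

Lemma bilinear_formE (R : comNzRingType) (N : nat) (u : 'rV[R]_N) (A : 'M[R]_N)
    (v : 'cV[R]_N) :
  (u *m A *m v) 0 0 = \sum_j \sum_i (u 0 i * v j 0) * A i j.
Proof.
rewrite mxE; apply: eq_bigr => j _; rewrite mxE mulr_suml.
by apply: eq_bigr => i _; rewrite mulrAC.
Qed.

Lemma continuous_entry (R : realType) (T : topologicalType) (m n : nat)
    (A : T -> 'M[R]_(m, n)) (i : 'I_m) (j : 'I_n) :
  continuous A -> continuous (fun x => A x i j).
Proof.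
move=> cA x; apply: (@continuous_comp _ _ _ A (fun M => M i j)).
  exact: cA.
exact: coord_continuous.
Qed.

Lemma continuous_bilinear_form (R : realType) (T : topologicalType) (N : nat)
    (A : T -> 'M[R]_N) (u : 'rV[R]_N) (v : 'cV[R]_N) :
  continuous A -> continuous (fun x => (u *m A x *m v) 0 0).
Proof.
move=> cA.
have cadd : continuous (fun x : R * R => x.1 + x.2) by exact: add_continuous.
rewrite (funext (fun x => bilinear_formE u (A x) v)).
apply: (continuous_big cadd) => j _; apply: (continuous_big cadd) => i _ x.
apply: cvgM; first exact: cvg_cst.
exact: continuous_entry.
Qed.

(** The form is a finite combination of the entries of [pi g] with coefficients independent of [g].
    These entries are continuous, hence integrable, and linearity of the integral applies. *)
Lemma haar_average_bilinear_form (R : realType) (G : topologicalGroupType)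
    (mu : probability (borel G) R) (N : nat) (pi : G -> 'M[R]_N)
    (u : 'rV[R]_N) (v : 'cV[R]_N) :
  compact [set: G] -> continuous pi ->
  (u *m haar_average mu pi *m v) 0 0 =
  \int[mu]_(g in [set: borel G]) (u *m pi g *m v) 0 0.
Proof.
move=> Gcompact cpi.
have cpiij i j := @continuous_entry _ _ _ _ _ i j cpi.
have ipi i j : mu.-integrable [set: borel G]
    (EFin \o (fun g => u 0 i * v j 0 * pi g i j)).
  apply: borel_continuous_integrable => // g.
  by apply: cvgM; [exact: cvg_cst|exact: cpiij].
rewrite bilinear_formE.
under [RHS]eq_Rintegral do rewrite bilinear_formE.
rewrite Rintegral_sum//; last first.
  move=> j; rewrite (_ : _ \o _ =
    (fun g => \sum_i (u 0 i * v j 0 * pi g i j)%:E)%E).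
    by apply: integrable_sum => // i _; exact: ipi.
  by apply/funext => g; rewrite /= sumEFin.
apply: eq_bigr => j _; rewrite Rintegral_sum//.
apply: eq_bigr => i _; rewrite RintegralZl//; first by rewrite mxE.
exact: borel_continuous_integrable.
Qed.

Lemma rep_haar_average (R : realType) (G : topologicalGroupType)
    (mu : probability (borel G) R) (N : nat) (pi : G -> 'M[R]_N) (g : G) :
  compact [set: G] -> normalized_haar mu -> continuous_representation pi ->
  pi g *m haar_average mu pi = haar_average mu pi.
Proof.
move=> Gcompact haar [_ piM cpi]; apply/matrixP => i j.
have cpiij := @continuous_entry _ _ _ _ _ i j cpi.
(* Entry [(i, j)] is read as a form in row [i] of [pi g] and the [j]-th basis vector. Averaging then
   gives the integral over [h] of the entry of [pi g *m pi h], that is, of [pi (g * h)], and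
   translation invariance removes [g]. *)
transitivity
  ((row i (pi g) *m haar_average mu pi *m (delta_mx j 0 : 'cV_N)) 0 0).
  by rewrite -row_mul -colE !mxE; apply: eq_bigr.
rewrite haar_average_bilinear_form// [RHS]mxE.
rewrite -(haar_Rintegral_mulg g Gcompact haar cpiij)//.
by apply: eq_Rintegral => h _; rewrite -row_mul -piM -colE !mxE.
Qed.

(** * Linear algebra of the range, interpolation and sign patterns *)

Lemma mem_range_space (R : fieldType) (N : nat) (A : 'M[R]_N) (x : 'cV[R]_N) :
  A *m x \in range_space A.
Proof. by rewrite -(lfunE (mulmx A)) memv_img ?memvf. Qed.

Lemma range_spaceP (R : fieldType) (N : nat) (A : 'M[R]_N) (y : 'cV[R]_N) :
  y \in range_space A -> exists x, y = A *m x.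
Proof. by case/memv_imgP => x _ ->; exists x; rewrite (lfunE (mulmx A)). Qed.

Lemma free_linear_form_interpolation (R : fieldType) (N P : nat) (X : P.-tuple 'cV[R]_N)
    (y : 'I_P -> R) :
  free X -> exists w : 'cV[R]_N, forall i : 'I_P, (w^T *m X`_i) 0 0 = y i.
Proof.
move=> Xfree.
(* The coordinate forms of [X] are dual to the free family, so [f] sends [X_i] to [y i]; the entries
   of [w] are the values of [f] on the canonical basis. *)
pose f v := \sum_i y i * coord X i v.
exists (\col_k f (delta_mx k 0)) => i.
have -> : y i = f X`_i.
  rewrite /f (bigD1 i)//= coord_free// eqxx mulr1 big1 ?addr0// => j ji.
  by rewrite coord_free// eq_sym (negbTE ji) mulr0.
rewrite [in RHS](matrix_sum_delta X`_i) /f.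
under [RHS]eq_bigr => j _.
  rewrite linear_sum mulr_sumr.
  under eq_bigr do rewrite big_ord1 linearZ/=.
  over.
rewrite exchange_big mxE; apply: eq_bigr => k _; rewrite !mxE mulr_suml.
by apply: eq_bigr => j _; rewrite mulrA mulrAC.
Qed.

(** Given a linear relation, take as labels the signs of its coefficients. Applying the separating
    [w] to the relation yields a vanishing sum of terms [|c i|] times a positive number, so every
    [c i] is zero. *)
Lemma shattered_free (R : realFieldType) (N P : nat) (X : P.-tuple 'cV[R]_N) :
  (forall y : 'I_P -> R, (forall i, y i \in [:: -1; 1]) ->
     exists w : 'cV[R]_N, forall i : 'I_P, 0 < y i * (w^T *m X`_i) 0 0) ->
  free X.
Proof.
move=> Xsh; apply/freeP => c c0.
(* A zero coefficient may get either label, since only [c i = |c i| * y i] matters. *)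
pose y i : R := if c i < 0 then -1 else 1.
have [i|w wy] := Xsh y; first by rewrite /y; case: ifP; rewrite !inE eqxx ?orbT.
have cy i : c i = `|c i| * y i.
  rewrite /y; case: ltrP => ci; first by rewrite ltr0_norm// mulrN1 opprK.
  by rewrite ger0_norm// mulr1.
have : \sum_i `|c i| * (y i * (w^T *m X`_i) 0 0) = 0.
  transitivity ((w^T *m \sum_i c i *: X`_i) 0 0).
    rewrite mulmx_sumr summxE; apply: eq_bigr => i _.
    by rewrite -scalemxAr [RHS]mxE {2}cy mulrA.
  by rewrite c0 mulmx0 mxE.
move/eqP; rewrite psumr_eq0 => [/allP h i|i _]; last first.
  by rewrite mulr_ge0// ltW.
have := h i (mem_index_enum _).
by rewrite mulf_eq0 normr_eq0 (gt_eqF (wy i)) orbF => /eqP.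
Qed.

Theorem corollary1 (R : realType) (G : topologicalGroupType)
    (mu : probability (borel G) R) (N : nat) (pi : G -> 'M[R]_N)
    (Gcompact : compact [set: G])
    (mu_haar : normalized_haar mu)
    (pi_rep : continuous_representation pi) :
  is_VC_dim pi (\dim (range_space (haar_average mu pi))).
Proof.
have [_ _ cpi] := pi_rep; set M := haar_average mu pi; set V := range_space M.
split=> [|P [r rsh]].
  exists (fun i => (vbasis V)`_i) => y y1.
  (* The labels themselves are the prescribed values of the functional, so every margin equals
     [y i * y i = 1]. *)
  have [w wy] :=
    free_linear_form_interpolation y (basis_free (vbasisP V)).
  exists w => -[i g] /=.
  have [x Xx] : exists x, (vbasis V)`_i = M *m x.
    by apply: range_spaceP; apply: vbasis_mem; rewrite mem_nth// size_tuple.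
  rewrite Xx [pi g *m _]mulmxA rep_haar_average// -Xx wy.
  by have := y1 i; rewrite !inE => /orP[] /eqP ->; rewrite ?mulrNN mulr1 ltr01.
pose X := [tuple M *m r i | i < P].
have XE (i : 'I_P) : X`_i = M *m r i by rewrite -tnth_nth tnth_mktuple.
have /eqP Xfree : free X.
  apply: shattered_free => y y1; have [w wsep] := rsh y y1.
  exists w => i; rewrite XE mulmxA.
  (* Absorbing the label into the row vector makes the whole signed margin a bilinear form, to which
     the averaging formula applies. *)
  have -> : y i * (w^T *m M *m r i) 0 0 = ((y i *: w^T) *m M *m r i) 0 0.
    by rewrite -!scalemxAl [RHS]mxE.
  rewrite haar_average_bilinear_form//; apply: Rintegral_gt0 => //.
    exact: continuous_bilinear_form.
  by move=> g; rewrite -!scalemxAl mxE -mulmxA; exact: (wsep (i, g)).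
have : (\dim <<X>>%VS <= \dim V)%N.
  by apply/dimvS/span_subvP => _ /mapP[i _ ->]; exact: mem_range_space.
by rewrite Xfree size_tuple.
Qed.
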